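(* For all integers $j\geq 2$ and $n\geq 2$, \[ m_j(K_{1,2}, P_4, nK_2)=\left\lfloor \frac{2n}{j} \right\rfloor+1. \]
   Context: All graphs are finite, simple and undirected. $K_{j\times t}$ denotes the complete multipartite graph with $j$ partite classes, each of size $t$. For graphs $G_1,\dots,G_k$ and an integer $j$, the size multipartite Ramsey number $m_j(G_1,\dots,G_k)$ is the smallest positive integer $t$ such that every $k$-coloring of the edges of $K_{j\times t}$ (colors $1,\dots,k$) contains, for some $i\in\{1,\dots,k\}$, a copy of $G_i$ all of whose edges have color $i$. $K_{1,2}$ is the star with two edges (a path on 3 vertices), $P_4$ is the path on 4 vertices, and $nK_2$ is the matching consisting of $n$ pairwise disjoint edges ($2n$ vertices). *)

(* Defs.v *)
From HB Require Import structures.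
From mathcomp Require Import all_boot.

Set Implicit Arguments.
Unset Strict Implicit.
Unset Printing Implicit Defensive.

Record sgraph := SGraph {
  vertex :> finType;
  adj : rel vertex;
  adj_sym : symmetric adj;
  adj_irr : irreflexive adj
}.

(* Complete multipartite graph with j classes of size t; the class of a vertex
   is its first component. *)
Section CompleteMultipartite.
Variables j t : nat.

Definition multipartite_adj : rel ('I_j * 'I_t) := fun u v => u.1 != v.1.

Lemma multipartite_adj_sym : symmetric multipartite_adj.
Proof. by move=> u v; rewrite /multipartite_adj eq_sym. Qed.

Lemma multipartite_adj_irr : irreflexive multipartite_adj.
Proof. by move=> u; rewrite /multipartite_adj eqxx. Qed.

Definition complete_multipartite : sgraph :=
  SGraph multipartite_adj_sym multipartite_adj_irr.
End CompleteMultipartite.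

Section CompleteBipartite.
Variables m n : nat.

Definition bipartite_adj : rel ('I_m + 'I_n) := fun u v =>
  match u, v with
  | inl _, inr _ | inr _, inl _ => true
  | _, _ => false
  end.

Lemma bipartite_adj_sym : symmetric bipartite_adj.
Proof. by case=> x []. Qed.

Lemma bipartite_adj_irr : irreflexive bipartite_adj.
Proof. by case. Qed.

Definition complete_bipartite : sgraph :=
  SGraph bipartite_adj_sym bipartite_adj_irr.
End CompleteBipartite.

(* Path on n vertices (not n edges). *)
Section PathGraph.
Variable n : nat.

Definition path_adj : rel 'I_n := fun u v => (u.+1 == v) || (v.+1 == u).

Lemma path_adj_sym : symmetric path_adj.
Proof. by move=> u v; rewrite /path_adj orbC. Qed.

Lemma path_adj_irr : irreflexive path_adj.
Proof. by move=> u; rewrite /path_adj orbb eqn_leq ltnn. Qed.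

Definition path_graph : sgraph := SGraph path_adj_sym path_adj_irr.
End PathGraph.

(* n disjoint edges; the i-th edge joins (i, false) and (i, true). *)
Section MatchingGraph.
Variable n : nat.

Definition matching_adj : rel ('I_n * bool) :=
  fun u v => (u.1 == v.1) && (u.2 != v.2).

Lemma matching_adj_sym : symmetric matching_adj.
Proof. by move=> u v; rewrite /matching_adj eq_sym [u.2 == _]eq_sym. Qed.

Lemma matching_adj_irr : irreflexive matching_adj.
Proof. by move=> u; rewrite /matching_adj !eqxx. Qed.

Definition matching_graph : sgraph := SGraph matching_adj_sym matching_adj_irr.
End MatchingGraph.

(* An edge {x, y} is the set [set x; y].  A colouring is a total function on
   vertex sets, but only its values on edges are ever used. *)
Definition edge_colouring (G : sgraph) (k : nat) := {set G} -> 'I_k.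

(* G has a (not necessarily induced) copy of H with all edges of colour i. *)
Definition mono_copy (H G : sgraph) (k : nat) (c : edge_colouring G k)
    (i : 'I_k) : Prop :=
  exists f : H -> G, injective f /\
    forall x y : H, adj x y ->
      adj (f x) (f y) /\ c [set f x; f y] = i.

Definition arrows (K : sgraph) (k : nat) (G : 'I_k -> sgraph) : Prop :=
  forall c : edge_colouring K k, exists i : 'I_k, mono_copy (G i) c i.

(* The family G_1, G_2, G_3, indexed from 0.  A tuple of graphs is ruled out by
   universe constraints. *)
Definition three_graphs (G1 G2 G3 : sgraph) : 'I_3 -> sgraph := fun i =>
  match val i with 0 => G1 | 1 => G2 | _ => G3 end.

(* [is_multipartite_ramsey j G t] states m_j(G_1, ..., G_k) = t.  It is a
   relation because no such t need exist for arbitrary j and G. *)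
Definition is_multipartite_ramsey (j k : nat) (G : 'I_k -> sgraph)
    (t : nat) : Prop :=
  [/\ 0 < t,
      arrows (complete_multipartite j t) G
    & forall s : nat, 0 < s -> arrows (complete_multipartite j s) G -> t <= s].

Lemma is_multipartite_ramsey_unique (j k : nat) (G : 'I_k -> sgraph)
    (t t' : nat) :
  is_multipartite_ramsey j G t -> is_multipartite_ramsey j G t' -> t = t'.
Proof.
move=> [t0 tA tmin] [t0' tA' tmin'].
by apply/eqP; rewrite eqn_leq tmin ?tmin'.
Qed.

(* Main.v *)
Require Import Defs.
From mathcomp Require Import all_boot.
From mathcomp Require Import zify.

(* With jt <= 2n vertices, colour all edges at one vertex 2 and all others 3:
   the second colour class is a star and the third misses a vertex.

   With jt > 2n vertices, let M be a matching of colour 3 with fewer than n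
   edges, leaving a set U of at least three free vertices.  If M cannot be
   enlarged, U has no edge of colour 3, and M has no augmenting path of length 3
   in colour 3.  Both facts force many edges of colours 1 and 2, whereas the
   union H of a matching c1 and a P_4-free graph is sparse: in a 4-cycle of H
   every vertex lies on a c1-edge of the cycle, and H contains neither K_{2,3}
   nor K_4 minus an edge.  A contradiction follows in each of the cases:
   U inside one class, inside two classes with one of them met once, inside two
   classes both met at least twice, or meeting three classes. *)

Set Implicit Arguments.
Unset Strict Implicit.
Unset Printing Implicit Defensive.

(** * Subgraphs that cannot occur in [H] *)

(* [H] is the union of the first two colours, [c1] is the first one. *)
Section SparseRelation.
Variables (T : finType) (H c1 : rel T).
Hypothesis H_sym : symmetric H.
Hypothesis H_irr : irreflexive H.
Hypothesis c1_sym : symmetric c1.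
Hypothesis c1_inj : forall a b d, c1 a b -> c1 a d -> b = d.
Hypothesis no_path : forall a b d e, H a b -> H b d -> H d e ->
  a != d -> b != e -> a != e -> [|| c1 a b, c1 b d | c1 d e].

Let H_neq a b : H a b -> a != b.
Proof. by apply: contraTneq => ->; rewrite H_irr. Qed.

(** The paths [a x b y] and [b x a y] each contain a [c1]-edge. If none is at [x], then [y] has the
    two [c1]-neighbours [a] and [b]. *)
Lemma square_c1 x y a b : x != y -> a != b ->
  H x a -> H x b -> H y a -> H y b -> c1 x a || c1 x b.
Proof.
move=> nxy nab xa xb ya yb.
have ax : H a x by rewrite H_sym.
have bx : H b x by rewrite H_sym.
have ay : H a y by rewrite H_sym.
have byy : H b y by rewrite H_sym.
have nba : b != a by rewrite eq_sym.
have [nay nby] := (H_neq ay, H_neq byy).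
case/or3P: (no_path ax xb byy nab nxy nay) => [h|->|h1]; last 1 first.
- case/or3P: (no_path bx xa ay nba nxy nby) => [h|->//|h2].
  + by rewrite (c1_sym x b) h orbT.
  + rewrite c1_sym in h1; rewrite c1_sym in h2.
    by rewrite (c1_inj h1 h2) eqxx in nab.
- by rewrite c1_sym h.
- by rewrite orbT.
Qed.

(** By [square_c1], any two of [a], [b], [d] include a [c1]-neighbour of [x]; but [x] has at most
    one. *)
Lemma no_K23 x y a b d : x != y -> a != b -> b != d -> a != d ->
  H x a -> H x b -> H x d -> H y a -> H y b -> H y d -> False.
Proof.
move=> nxy nab nbd nad xa xb xd ya yb yd.
case/orP: (square_c1 nxy nab xa xb ya yb) => h1;
  case/orP: (square_c1 nxy nbd xb xd yb yd) => h2;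
  case/orP: (square_c1 nxy nad xa xd ya yd) => h3;
  first [ by rewrite (c1_inj h1 h2) eqxx in nab
        | by rewrite (c1_inj h1 h2) eqxx in nad
        | by rewrite (c1_inj h2 h1) eqxx in nbd
        | by rewrite (c1_inj h1 h3) eqxx in nad
        | by rewrite (c1_inj h3 h1) eqxx in nab
        | by rewrite (c1_inj h2 h3) eqxx in nbd ].
Qed.

(** Up to swapping [b] and [c], the 4-cycle [a b d c] has [c1]-edges [a b] and [d c]; the path
    [a c b d] then has none. As [a] and [d] may be adjacent, [K_4] is covered too. *)
Lemma no_diamond a d b c : a != d -> H a b -> H a c -> H d b -> H d c ->
  H b c -> False.
Proof.
move=> nad; wlog ab1 : b c / c1 a b => [wl|] ab ac db dc bc.
  have nbc := H_neq bc.
  case/orP: (square_c1 nad nbc ab ac db dc) => h; first exact: (wl b c).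
  by apply: (wl c b); rewrite // H_sym.
have [[nbc nab] ndc] := (H_neq bc, H_neq ab, H_neq dc).
rewrite c1_sym in ab1.
have dc1 : c1 d c.
  rewrite eq_sym in nad; case/orP: (square_c1 nad nbc db dc ab ac) => //.
  by rewrite c1_sym => /(c1_inj ab1) /eqP; rewrite eq_sym (negPf nad).
rewrite c1_sym in dc1.
have cb : H c b by rewrite H_sym.
have bd : H b d by rewrite H_sym.
rewrite eq_sym in ndc.
case/or3P: (no_path ac cb bd nab ndc nad) => h.
- rewrite c1_sym in ab1.
  by move: nbc; rewrite (c1_inj ab1 h) eqxx.
- by move: bd; rewrite (c1_inj dc1 h) H_irr.
- by move: nad; rewrite (c1_inj ab1 h) eqxx.
Qed.

(* A triangle with two pendant edges is sparse only if the pendant edges lie in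
   [c1] and the triangle avoids it. *)
Lemma bull_c1 u v w x y : H u v -> H u w -> H v w -> H x v -> H y w ->
  x != u -> x != w -> y != u -> y != v -> x != y -> c1 v x && c1 w y.
Proof.
move=> uv uw vw xv yw nxu nxw nyu nyv nxy.
have vu : H v u by rewrite H_sym.
have wu : H w u by rewrite H_sym.
have wv : H w v by rewrite H_sym.
have [[nuv nuw] nvw] := (H_neq uv, H_neq uw, H_neq vw).
have [[nvu nwu] nwv] := (H_neq vu, H_neq wu, H_neq wv).
have D a b d : b != d -> c1 a b -> c1 d a -> False.
  by rewrite (c1_sym d) => n h h'; rewrite (c1_inj h h') eqxx in n.
have S a b : c1 a b -> c1 b a by rewrite c1_sym.
have nux : u != x by rewrite eq_sym.
have nuy : u != y by rewrite eq_sym.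
have nwx : w != x by rewrite eq_sym.
have nvy : v != y by rewrite eq_sym.
(* If a triangle edge were in [c1], some path of three other edges, each sharing a vertex with it,
   would avoid [c1]. *)
have Nvw : ~ c1 v w.
  move=> h; case/or3P: (no_path xv vu uw nxu nvw nxw) => h'.
  - exact: D nwx h h'.
  - exact: D nwu h (S _ _ h').
  - exact: D nvu (S _ _ h) h'.
have Nuv : ~ c1 u v.
  move=> h; case/or3P: (no_path xv vw wu nxw nvu nxu) => h'.
  - exact: D nux (S _ _ h) h'.
  - exact: Nvw.
  - exact: D nvw h h'.
have Nuw : ~ c1 u w.
  move=> h; case/or3P: (no_path yw wv vu nyv nwu nyu) => h'.
  - exact: D nuy (S _ _ h) h'.
  - exact: Nvw (S _ _ h').
  - exact: D nwv h h'.
case/or3P: (no_path xv vu uw nxu nvw nxw) => [/S ->|/S //|//].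
by case/or3P: (no_path yw wu uv nyu nwv nyv) => [/S ->|/S //|//].
Qed.

(* [cl] gives the partite class, [U] the vertices not covered by a matching and
   [e] its edges; [e_blocked] excludes the augmenting path [u - x - y - v]. *)
Variables (I : eqType) (cl : T -> I) (U : {set T}) (e : rel T).
Hypothesis H_free : {in U &, forall u v, cl u != cl v -> H u v}.
Hypothesis e_sym : symmetric e.
Hypothesis e_cl : forall x y, e x y -> cl x != cl y.
Hypothesis e_used : forall x y, e x y -> x \notin U.
Hypothesis e_blocked : forall x y u v, e x y -> u \in U -> v \in U -> u != v ->
  cl u != cl x -> cl v != cl y -> H u x || H v y.

Let e_usedr x y : e x y -> y \notin U.
Proof. by rewrite e_sym; apply: e_used. Qed.

Let U_neq u x : u \in U -> x \notin U -> u != x.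
Proof. by move=> uU; apply: contraNneq => <-. Qed.

Let e_neq x y : e x y -> x != y.
Proof. by move=> /e_cl; apply: contraNneq => ->. Qed.

Let cl_neq x y : cl x != cl y -> x != y.
Proof. by apply: contraNneq => ->. Qed.

(** * Free vertices within one or two classes *)

Definition free_in p := [set u in U | cl u == p].
Definition outside p : rel T := fun x y => (cl x != p) && (cl y != p).

Lemma free_inP p u : reflect (u \in U /\ cl u = p) (u \in free_in p).
Proof. by rewrite inE; apply: (iffP andP) => -[-> /eqP]. Qed.

(** By [e_blocked], [H a x || H b y] for all distinct [a], [b] in [L]. If some [b] misses [x], all
    others see [y]; then either [b] sees [y] too, or it misses both ends and all others also see
    [x]. *)
Lemma outside_dichotomy p (L : {set T}) x y : e x y -> outside p x y ->
  L \subset free_in p ->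
  (exists2 z, z \in [:: x; y] & {in L, forall a, H a z}) \/
  (exists2 b, b \in L & [/\ ~~ H b x, ~~ H b y &
     {in L, forall a, a != b -> H a x && H a y}]).
Proof.
move=> exy /andP[px py] /subsetP LU.
have blocked a b : a \in L -> b \in L -> a != b -> H a x || H b y.
  move=> /LU/free_inP[aU ap] /LU/free_inP[bU bp] nab.
  by apply: e_blocked; rewrite ?ap ?bp // eq_sym.
case: (boolP [forall a in L, H a x]) => [/forall_inP h|].
  by left; exists x; rewrite ?mem_head.
case/forall_inPn => b bL Nbx.
have hy a : a \in L -> a != b -> H a y.
  by move=> aL nab; have := blocked b a bL aL; rewrite eq_sym (negPf Nbx); apply.
case: (boolP (H b y)) => [byy|Nby].
  left; exists y; first by rewrite !inE eqxx orbT.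
  by move=> a aL; case: (eqVneq a b) => [->//|]; apply: hy.
right; exists b => //; split=> // a aL nab; rewrite hy // andbT.
by have := blocked a b aL bL nab; rewrite (negPf Nby) orbF.
Qed.

(** Either an end of the edge is, like [z], joined to three free vertices, or two free vertices are
    both joined to [x], [y] and [z]: a [K_{2,3}] in both cases. *)
Lemma star_no_outside p z x y : 2 < #|free_in p| ->
  {in free_in p, forall a, H a z} -> z != x -> z != y -> e x y ->
  outside p x y -> False.
Proof.
move=> L3 Lz nzx nzy exy oxy.
have nxy := e_neq exy.
case: (outside_dichotomy exy oxy (subxx _)) => [[w wxy Lw]|[b bL [_ _ Lxy]]].
  have /card_gt2P[a [b [d [[aL bL dL] [nab nbd nda]]]]] := L3.
  rewrite eq_sym in nda.
  have nzw : z != w by move: wxy; rewrite !inE => /orP[]/eqP->.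
  by apply: (no_K23 nzw nab nbd nda); rewrite H_sym ?Lz ?Lw.
have /card_gt1P[v [w []]] : 1 < #|free_in p :\ b|.
  by move: L3; rewrite (cardsD1 b) bL.
rewrite !in_setD1 => /andP[nvb vL] /andP[nwb wL] nvw.
have /andP[vx vy] := Lxy v vL nvb; have /andP[wx wy] := Lxy w wL nwb.
by apply: (no_K23 nvw nzx nxy nzy); rewrite ?Lz.
Qed.

(** By [star_no_outside], no end of either edge is joined to all of [free_in p], so each edge has
    one exceptional free vertex. Any other vertex [a] of [free_in p] has a [c1]-neighbour on both
    edges. *)
Lemma one_class_no_two_outside p x y x' y' : 2 < #|free_in p| ->
  e x y -> e x' y' -> outside p x y -> outside p x' y' ->
  uniq [:: x; y; x'; y'] -> False.
Proof.
move=> L3 exy exy' oxy oxy' /=; rewrite !inE !negb_or !andbT.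
case/and3P=> /and3P[nxy nxx' nxy'] /andP[nyx' nyy'] nxy2.
have c1_pair u v b : e u v -> b \in free_in p ->
    {in free_in p, forall a, a != b -> H a u && H a v} ->
    {in free_in p, forall a, a != b -> c1 a u || c1 a v}.
  move=> /e_neq nuv bL Luv a aL nab.
  have /card_gt0P[w] : 0 < #|free_in p :\ b :\ a|.
    by move: L3; rewrite (cardsD1 b) bL (cardsD1 a) in_setD1 nab aL.
  rewrite !in_setD1 => /and3P[nwa nwb wL].
  have /andP[au av] := Luv a aL nab; have /andP[wu wv] := Luv w wL nwb.
  by apply: (@square_c1 a w); rewrite // eq_sym.
case: (outside_dichotomy exy oxy (subxx _)) => [[w wxy Lw]|[b bL [_ _ Lb]]].
  by apply: (star_no_outside L3 Lw _ _ exy' oxy'); move: wxy; rewrite !inE => /orP[]/eqP->.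
case: (outside_dichotomy exy' oxy' (subxx _)) => [[w wxy Lw]|[b' bL' [_ _ Lb']]].
  apply: (star_no_outside L3 Lw _ _ exy oxy); move: wxy;
    by rewrite !inE => /orP[]/eqP->; rewrite eq_sym.
have /card_gt0P[a] : 0 < #|free_in p :\ b :\ b'|.
  by move: L3; rewrite (cardsD1 b) bL (cardsD1 b'); case: (_ \in _) => /=; lia.
rewrite !in_setD1 => /and3P[nab' nab aL].
case/orP: (c1_pair _ _ _ exy bL Lb a aL nab) => h;
  case/orP: (c1_pair _ _ _ exy' bL' Lb' a aL nab') => h';
  first [ by rewrite (c1_inj h h') eqxx in nxx' | by rewrite (c1_inj h h') eqxx in nxy'
        | by rewrite (c1_inj h h') eqxx in nyx' | by rewrite (c1_inj h h') eqxx in nyy' ].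
Qed.

(** If an end [z] sees both [a] and [b], the cycle [c a z b] gives the two [c1]-edges. Otherwise one
    of [a], [b] sees neither end and the other sees both; [c] is then forced to see an end, and
    [bull_c1] applies. *)
Lemma cherry_outside p c a b x y : c \in U -> cl c != p ->
  a \in free_in p -> b \in free_in p -> a != b -> e x y -> outside p x y ->
  exists2 z, z \in [:: x; y] & (c1 c a && c1 b z) || (c1 c b && c1 a z).
Proof.
move=> cU cp aL bL nab exy oxy.
have Hc u : u \in free_in p -> H u c.
  by case/free_inP=> uU up; apply: H_free; rewrite // up eq_sym.
have c_neq z : z \in [:: x; y] -> c != z.
  by rewrite !inE => /orP[]/eqP->; apply: U_neq; rewrite ?(e_used exy) ?(e_usedr exy).
have half u w : u \in free_in p -> w \in free_in p -> u != w ->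
    ~~ H u x -> ~~ H u y -> H w x && H w y ->
    exists2 z, z \in [:: x; y] & c1 c u && c1 w z.
  move=> uL wL nuw Nux Nuy /andP[wx wy].
  have [uU up] := free_inP _ _ uL; have [wU wp] := free_inP _ _ wL.
  have nuc := H_neq (Hc u uL).
  have /andP[px py] := oxy.
  (* The triangle is [z c w], with pendant vertices [u] at [c] and [z'] at [w]. *)
  have pendant z z' : e z z' -> z \in [:: x; y] -> z' \in [:: x; y] ->
      H w z -> H w z' -> H c z -> c1 c u && c1 w z'.
    move=> ezz' zxy zxy' wz wz' cz.
    apply: (@bull_c1 z c w); rewrite // 1?H_sym ?Hc //.
    - by rewrite H_sym Hc.
    - by apply: U_neq uU _; apply: e_used ezz'.
    - by rewrite eq_sym; apply: e_neq.
    - by rewrite eq_sym c_neq.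
    - by apply: U_neq uU _; apply: e_usedr ezz'.
  have cxy : cl c != cl y -> H c y.
    move=> ncy; have := e_blocked exy uU cU nuc.
    by rewrite (negPf Nux) up eq_sym; apply.
  have cyx : cl c != cl x -> H c x.
    rewrite e_sym in exy.
    move=> ncx; have := e_blocked exy uU cU nuc.
    by rewrite (negPf Nuy) up eq_sym; apply.
  have xin : x \in [:: x; y] by rewrite mem_head.
  have yin : y \in [:: x; y] by rewrite !inE eqxx orbT.
  (* The ends lie in different classes, so [c] is outside the class of one of them and, as [u] sees
     neither, is joined to it. *)
  case: (eqVneq (cl c) (cl y)) => [cy|ncy].
    exists y; rewrite // (pendant x) // cyx //.
    by rewrite cy eq_sym; apply: e_cl.
  by exists x; rewrite // (pendant y) 1?e_sym // cxy.
have sub : [set a; b] \subset free_in p.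
  by apply/subsetP => u; rewrite !inE => /orP[]/eqP->; move: aL bL; rewrite !inE.
case: (outside_dichotomy exy oxy sub) => [[z zxy Lz]|[u]].
  exists z => //.
  have [az bz] : H a z /\ H b z by rewrite !Lz // !inE eqxx ?orbT.
  have ncz := c_neq _ zxy; have [ac bc] := (Hc a aL, Hc b bL).
  have nba : b != a by rewrite eq_sym.
  have [ca cb] : H c a /\ H c b by rewrite !(H_sym c).
  have [za zb] : H z a /\ H z b by rewrite !(H_sym z).
  case/orP: (square_c1 ncz nab ca cb za zb) => h; rewrite h /=.
    case/orP: (square_c1 nba ncz bc bz ac az) => [|-> //].
    by rewrite c1_sym => /(c1_inj h) E; rewrite E eqxx in nab.
  case/orP: (square_c1 nab ncz ac az bc bz) => [|->]; last by rewrite orbT.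
  by rewrite c1_sym => /(c1_inj h) E; rewrite E eqxx in nab.
rewrite !inE => /orP[]/eqP-> [Nx Ny Lxy].
  have /(half a b aL bL nab Nx Ny)[z zxy h] : H b x && H b y.
    by apply: Lxy; rewrite ?inE ?eqxx ?orbT // eq_sym.
  by exists z; rewrite // h.
have /(half b a bL aL _ Nx Ny)[|z zxy h] : H a x && H a y.
    by apply: Lxy; rewrite ?inE ?eqxx ?orbT.
  by rewrite eq_sym.
by exists z; rewrite // h orbT.
Qed.

(* [c1] can join [c] to one of [a], [b] only, so both edges give a
   [c1]-neighbour of the other one. *)
Lemma cherry_no_two_outside p c a b x y x' y' : c \in U -> cl c != p ->
  a \in free_in p -> b \in free_in p -> a != b ->
  e x y -> e x' y' -> outside p x y -> outside p x' y' ->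
  uniq [:: x; y; x'; y'] -> False.
Proof.
move=> cU cp aL bL nab exy exy' oxy oxy' un.
have [z zxy hz] := cherry_outside cU cp aL bL nab exy oxy.
have [z' zxy' hz'] := cherry_outside cU cp aL bL nab exy' oxy'.
have nzz' : z != z'.
  move: un zxy zxy'; rewrite /= !inE !negb_or !andbT.
  case/and3P=> /and3P[_ ? ?] /andP[? ?] _.
  by move=> /orP[]/eqP-> /orP[]/eqP->.
case/orP: hz => /andP[h1 h2]; case/orP: hz' => /andP[h3 h4].
- by rewrite (c1_inj h2 h4) eqxx in nzz'.
- by rewrite (c1_inj h1 h3) eqxx in nab.
- by rewrite (c1_inj h3 h1) eqxx in nab.
- by rewrite (c1_inj h2 h4) eqxx in nzz'.
Qed.

(** The four vertices span a 4-cycle of [H]; a further common neighbour of [a], [a'] or of [b], [b']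
    would complete a [K_{2,3}]. Another free vertex is one because it avoids [p] or [q], and a
    matching edge has such an end by [e_blocked]. *)
Lemma free_square_blocks p q a a' b b' : p != q -> a != a' -> b != b' ->
  a \in free_in p -> a' \in free_in p -> b \in free_in q -> b' \in free_in q ->
  (forall x y, ~~ e x y) /\ U \subset [:: a; a'; b; b'].
Proof.
move=> npq naa' nbb' /free_inP[aU ap] /free_inP[aU' ap'] /free_inP[bU bq]
  /free_inP[bU' bq'].
have ab : H a b by apply: H_free; rewrite // ap bq.
have ab' : H a b' by apply: H_free; rewrite // ap bq'.
have a'b : H a' b by apply: H_free; rewrite // ap' bq.
have a'b' : H a' b' by apply: H_free; rewrite // ap' bq'.
have fromA z : z \notin [:: b; b'] -> H a z -> H a' z -> False.
  rewrite !inE negb_or ![z == _]eq_sym => /andP[nbz nbz'] az az'.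
  by apply: (@no_K23 a a' b b' z).
have fromB z : z \notin [:: a; a'] -> H b z -> H b' z -> False.
  rewrite !inE negb_or ![z == _]eq_sym => /andP[naz naz'] bz bz'.
  by apply: (@no_K23 b b' a a' z); rewrite // H_sym.
have notU z v v' : v \in U -> v' \in U -> z \notin U -> z \notin [:: v; v'].
  by move=> vU vU'; apply: contraNN; rewrite !inE => /orP[]/eqP->.
have key x y : e x y -> cl x != q -> cl y != p -> False.
  move=> exy nxq nyp.
  have blocked u v : u \in [:: b; b'] -> v \in [:: a; a'] -> H u x || H v y.
    rewrite !inE => uB vA; apply: e_blocked => //.
    - by case/orP: uB => /eqP->.
    - by case/orP: vA => /eqP->.
    - apply: cl_neq; case/orP: uB => /eqP->; case/orP: vA => /eqP->;
        by rewrite ?bq ?bq' ?ap ?ap' eq_sym.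
    - by case/orP: uB => /eqP->; rewrite ?bq ?bq' eq_sym.
    - by case/orP: vA => /eqP->; rewrite ?ap ?ap' eq_sym.
  have HA v : v \in [:: a; a'] -> H v y.
    move=> vA; case: (boolP (H v y)) => // Nv; exfalso.
    by apply: (@fromB x); [apply: notU (e_used exy) | |];
      (try by []); [have := blocked b v _ vA | have := blocked b' v _ vA];
      rewrite (negPf Nv) orbF; apply; rewrite !inE eqxx ?orbT.
  by apply: (@fromA y); [apply: notU (e_usedr exy) | |]; rewrite ?HA ?inE ?eqxx ?orbT.
split=> [x y|].
  apply/negP=> exy; have nxy := e_cl exy.
  case: (eqVneq (cl x) q) => [xq|nxq].
    by apply: (@key y x); [rewrite e_sym | rewrite -xq eq_sym | rewrite xq eq_sym].
  case: (eqVneq (cl y) p) => [yp|nyp]; last exact: (@key x y).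
  by apply: (@key y x); [rewrite e_sym | rewrite yp | rewrite -yp].
apply/subsetP=> z zU; apply: contraT => nz; exfalso.
move: nz; rewrite !inE !negb_or => /and4P[nza nza' nzb nzb'].
case: (eqVneq (cl z) p) => [zp|nzp].
  by apply: (@fromB z); rewrite ?inE ?negb_or ?nza ?nza' //; apply: H_free;
    rewrite // zp ?bq ?bq' eq_sym.
by apply: (@fromA z); rewrite ?inE ?negb_or ?nzb ?nzb' //; apply: H_free;
  rewrite // ?ap ?ap' eq_sym.
Qed.

(** * Free vertices in three classes *)

Section Triangle.
Variables u v w : T.
Hypotheses (uU : u \in U) (vU : v \in U) (wU : w \in U).
Hypotheses (nuv : cl u != cl v) (nuw : cl u != cl w) (nvw : cl v != cl w).

Let uv : H u v. Proof. exact: H_free. Qed.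
Let uw : H u w. Proof. exact: H_free. Qed.
Let vw : H v w. Proof. exact: H_free. Qed.

(** A fourth free vertex would share its class with at most one of [u], [v], [w], hence see two of
    them and complete a diamond. *)
Lemma triangle_free : U \subset [:: u; v; w].
Proof.
apply/subsetP=> z zU; apply: contraT => nz; exfalso.
move: nz; rewrite !inE !negb_or ![z == _]eq_sym => /and3P[nzu nzv nzw].
have Hz a : a \in U -> cl z != cl a -> H z a by move=> aU; apply: H_free.
case: (eqVneq (cl z) (cl u)) => [zu|nu].
  by apply: (no_diamond nzu uv uw _ _ vw); apply: Hz; rewrite // zu.
have vu : H v u by rewrite H_sym.
have zHu : H z u by apply: Hz.
case: (eqVneq (cl z) (cl v)) => [zv|nv].
  by apply: (no_diamond nzv vu vw zHu _ uw); apply: Hz; rewrite // zv.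
have [wu wv] : H w u /\ H w v by rewrite !(H_sym w).
by apply: (no_diamond nzw wu wv zHu _ uv); apply: Hz.
Qed.

End Triangle.

(** As [u] misses [x], each of [v], [w] sees [y] or lies in its class; say [v] sees [y]. Excluding
    diamonds, [w] lies in the class of [y] and sees [x], and [v] lies in the class of [x]. The
    triangle with pendant vertices [x] and [y] then falls under [bull_c1]. *)
Lemma triangle_blocked u v w x y : u \in U -> v \in U -> w \in U ->
  cl u != cl v -> cl u != cl w -> cl v != cl w -> e x y ->
  ~~ H u x -> cl u != cl x ->
  [/\ c1 v y, c1 w x & cl v = cl x] \/ [/\ c1 v x, c1 w y & cl w = cl x].
Proof.
move=> uU vU wU; wlog vy : v w vU wU / H v y => [wl|] nuv nuw nvw exy Nux nux.
  case: (boolP (H v y)) => [vy|Nvy]; first exact: (wl v w).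
  case: (boolP (H w y)) => [wy|Nwy].
    by case: (wl w v) => //; rewrite 1?eq_sym // => -[] ? ? ?; [right|left].
  have blocked a : a \in U -> cl u != cl a -> ~~ H a y -> cl a = cl y.
    move=> aU nua Nay; apply/eqP; apply: contraT => nay.
    by have := e_blocked exy uU aU (cl_neq nua) nux nay; rewrite (negPf Nux) (negPf Nay).
  by move: nvw; rewrite (blocked v) // (blocked w) // eqxx.
have [uv uw vw] : [/\ H u v, H u w & H v w] by split; apply: H_free.
have [xU yU] := (e_used exy, e_usedr exy).
have dia a b d z : a \in U -> z \notin U -> H a b -> H a d -> H b d -> H b z ->
    ~~ H d z.
  move=> aU zU ab ad bd bz; apply/negP=> dz.
  by apply: (no_diamond (U_neq aU zU) ab ad _ _ bd); rewrite H_sym.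
have Nwy : ~~ H w y := dia u v w y uU yU uv uw vw vy.
have wy : cl w = cl y.
  apply/eqP; apply: contraT => nwy.
  by have := e_blocked exy uU wU (cl_neq nuw) nux nwy; rewrite (negPf Nux) (negPf Nwy).
have Nuy : ~~ H u y.
  by apply: (dia w v u y wU yU) => //; rewrite H_sym.
have nuy : cl u != cl y by rewrite -wy.
have nyx := e_cl exy; rewrite eq_sym in nyx.
rewrite e_sym in exy.
have wx : H w x.
  have := e_blocked exy uU wU (cl_neq nuw) nuy.
  by rewrite (negPf Nuy) wy; apply.
have Nvx : ~~ H v x.
  by apply: (dia u w v x) => //; rewrite H_sym.
have vx : cl v = cl x.
  apply/eqP; apply: contraT => nvx.
  by have := e_blocked exy uU vU (cl_neq nuv) nuy nvx; rewrite (negPf Nuy) (negPf Nvx).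
have wv : H w v by rewrite H_sym.
have [xw yv] : H x w /\ H y v by rewrite !(H_sym _ w) !(H_sym _ v).
have /andP[] : c1 w x && c1 v y; last by left.
by apply: (bull_c1 uw uv wv xw yv); rewrite eq_sym; first [exact: U_neq | exact: e_neq].
Qed.

Definition c1_touches x y a := c1 a x || c1 a y.

(** If some triangle vertex misses [x] from another class, [triangle_blocked] applies. Otherwise at
    least two of the three see [x], which gives a diamond. *)
Lemma triangle_edge u v w x y : u \in U -> v \in U -> w \in U ->
  cl u != cl v -> cl u != cl w -> cl v != cl w -> e x y ->
  [|| c1_touches x y u && c1_touches x y v, c1_touches x y u && c1_touches x y w
    | c1_touches x y v && c1_touches x y w] && (cl x \in [:: cl u; cl v; cl w]).
Proof.
move=> uU vU wU nuv nuw nvw exy.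
have [nvu nwu] : cl v != cl u /\ cl w != cl u by rewrite ![_ == cl u]eq_sym.
have nwv : cl w != cl v by rewrite eq_sym.
have fromu := triangle_blocked uU vU wU nuv nuw nvw exy.
have fromv := triangle_blocked vU uU wU nvu nvw nuw exy.
have fromw := triangle_blocked wU uU vU nwu nwv nuv exy.
rewrite /c1_touches !inE.
case: (boolP (~~ H u x && (cl u != cl x))) => [/andP[h1 h2]|hu].
  by case: (fromu h1 h2) => -[-> -> ->]; rewrite eqxx !orbT.
case: (boolP (~~ H v x && (cl v != cl x))) => [/andP[h1 h2]|hv].
  by case: (fromv h1 h2) => -[-> -> ->]; rewrite eqxx !orbT.
case: (boolP (~~ H w x && (cl w != cl x))) => [/andP[h1 h2]|hw].
  by case: (fromw h1 h2) => -[-> -> ->]; rewrite eqxx !orbT.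
exfalso; have xU := e_used exy.
have [uv uw vw] : [/\ H u v, H u w & H v w] by split; apply: H_free.
have dia a b d : a \in U -> H a b -> H a d -> H b d -> H b x -> H d x -> False.
  by move=> aU ab ad bd bx dx; apply: (no_diamond (U_neq aU xU) ab ad _ _ bd); rewrite H_sym.
have [vu wu] : H v u /\ H w u by rewrite !(H_sym _ u).
have wv : H w v by rewrite H_sym.
move: hu hv hw; rewrite !negb_and !negbK.
case/orP=> [hu|/eqP hu]; case/orP=> [hv|/eqP hv]; case/orP=> [hw|/eqP hw];
  first [ exact: (dia w u v) | exact: (dia v u w) | exact: (dia u v w)
        | by rewrite hu hv eqxx in nuv | by rewrite hu hw eqxx in nuw
        | by rewrite hv hw eqxx in nvw ].
Qed.

(* Each edge has [c1]-neighbours at two of [u], [v], [w], so two edges share one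
   of them. *)
Lemma triangle_no_two_edges u v w x y x' y' : u \in U -> v \in U -> w \in U ->
  cl u != cl v -> cl u != cl w -> cl v != cl w -> e x y -> e x' y' ->
  uniq [:: x; y; x'; y'] -> False.
Proof.
move=> uU vU wU nuv nuw nvw exy exy' /=; rewrite !inE !negb_or !andbT.
case/and3P=> /and3P[_ n1 n2] /andP[n3 n4] _.
have /andP[h _] := triangle_edge uU vU wU nuv nuw nvw exy.
have /andP[h' _] := triangle_edge uU vU wU nuv nuw nvw exy'.
have excl a : c1_touches x y a -> c1_touches x' y' a -> False.
  by case/orP=> k /orP[] k'; [move: n1|move: n2|move: n3|move: n4];
    rewrite (c1_inj k k') eqxx.
by case/or3P: h => /andP[h1 h2]; case/or3P: h' => /andP[h3 h4];
  first [exact: (excl u) | exact: (excl v) | exact: (excl w)].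
Qed.

End SparseRelation.

(** * Matchings as lists of ordered pairs *)

Definition ends (T : Type) (M : seq (T * T)) : seq T :=
  flatten [seq [:: x.1; x.2] | x <- M].

Definition is_matching (T : eqType) (c : rel T) (M : seq (T * T)) :=
  uniq (ends M) && all (fun x => c x.1 x.2) M.

Lemma size_ends (T : Type) (M : seq (T * T)) : size (ends M) = (size M).*2.
Proof. by elim: M => //= -[x y] M ->. Qed.

Lemma nth_ends (T : Type) (x0 : T) (M : seq (T * T)) i (b : bool) :
  i < size M ->
  nth x0 (ends M) (i.*2 + b) =
    let x := nth (x0, x0) M i in if b then x.2 else x.1.
Proof. by elim: M i => // -[x y] M IH [|i]; [case: b IH | apply: IH]. Qed.

Lemma mem_ends (T : eqType) (M : seq (T * T)) x y : (x, y) \in M ->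
  x \in ends M /\ y \in ends M.
Proof.
by move=> xyM; split; apply/flattenP; exists [:: x; y];
  rewrite ?inE ?eqxx ?orbT //; apply/mapP; exists (x, y).
Qed.

Lemma perm_ends (T : eqType) (M M' : seq (T * T)) :
  perm_eq M M' -> perm_eq (ends M) (ends M').
Proof. by move=> MM'; apply/perm_flatten/perm_map. Qed.

Lemma perm_is_matching (T : eqType) (c : rel T) (M M' : seq (T * T)) :
  perm_eq M M' -> is_matching c M = is_matching c M'.
Proof.
move=> MM'; rewrite /is_matching (perm_uniq (perm_ends MM')).
by rewrite (perm_all _ MM').
Qed.

(** * Counting around a matching that cannot be enlarged *)

Section NoAugmentation.
Variables (T I : finType) (cl : T -> I) (t : nat) (H c1 c3 : rel T).
Hypothesis H_sym : symmetric H.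
Hypothesis H_irr : irreflexive H.
Hypothesis c1_sym : symmetric c1.
Hypothesis c1_inj : forall a b d, c1 a b -> c1 a d -> b = d.
Hypothesis no_path : forall a b d e, H a b -> H b d -> H d e ->
  a != d -> b != e -> a != e -> [|| c1 a b, c1 b d | c1 d e].
Hypothesis c3_sym : symmetric c3.
Hypothesis c3_cl : forall x y, c3 x y -> cl x != cl y.
Hypothesis H_or_c3 : forall x y, cl x != cl y -> H x y || c3 x y.
Hypothesis card_class : forall p, #|[set x | cl x == p]| = t.

Variable M : seq (T * T).
Hypothesis M_matching : is_matching c3 M.
Hypothesis M_max : forall M', is_matching c3 M' -> size M' != (size M).+1.

Let U := [set x | x \notin ends M].
Let e : rel T := fun x y => ((x, y) \in M) || ((y, x) \in M).

Let M_uniq : uniq (ends M). Proof. by case/andP: M_matching. Qed.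

Let cardT : #|T| = #|I| * t.
Proof.
rewrite -sum1_card (partition_big cl predT) //= -sum_nat_const.
by apply: eq_bigr => p _; rewrite sum1dep_card card_class.
Qed.

Lemma card_free : #|U| + (size M).*2 = #|T|.
Proof.
rewrite -size_ends -(card_uniqP M_uniq) -(cardC (mem (ends M))) addnC.
by congr (_ + _); apply: eq_card => x; rewrite !inE.
Qed.

Let e_sym : symmetric e. Proof. by move=> x y; rewrite /e orbC. Qed.

Let e_c3 x y : e x y -> c3 x y.
Proof.
have /andP[_ /allP c3M] := M_matching.
by case/orP=> /c3M //=; rewrite c3_sym.
Qed.

Let e_cl x y : e x y -> cl x != cl y. Proof. by move/e_c3/c3_cl. Qed.

Let e_used x y : e x y -> x \notin U.
Proof. by rewrite inE negbK => /orP[] /mem_ends[]. Qed.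

(** Otherwise [(u, v)] would have colour 3 and could be added to [M]. *)
Let H_free : {in U &, forall u v, cl u != cl v -> H u v}.
Proof.
move=> u v; rewrite !inE => uM vM nuv.
case/orP: (H_or_c3 nuv) => // uv.
suff /M_max : is_matching c3 ((u, v) :: M) by rewrite eqxx.
have /andP[uniM allM] := M_matching.
rewrite /is_matching /= uv allM andbT inE negb_or uM vM uniM !andbT.
by apply: contraNneq nuv => ->.
Qed.

(** Otherwise [(u, x)] and [(v, y)] would have colour 3 and could replace [(x, y)]. *)
Let e_blocked x y u v : e x y -> u \in U -> v \in U -> u != v ->
  cl u != cl x -> cl v != cl y -> H u x || H v y.
Proof.
wlog xyM : x y u v / (x, y) \in M => [wl|] exy uU vU nuv nux nvy.
  case/orP: (exy) => h; first exact: wl.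
  by rewrite orbC; apply: wl; rewrite // 1?e_sym // eq_sym.
case/orP: (H_or_c3 nux) => [->//|ux]; case/orP: (H_or_c3 nvy) => [->|vy].
  by rewrite orbT.
have pM := perm_to_rem xyM; set M' := rem _ _ in pM.
suff /M_max : is_matching c3 [:: (u, x), (y, v) & M'].
  by rewrite (perm_size pM) eqxx.
have /andP[uniM allM] : is_matching c3 ((x, y) :: M').
  by rewrite -(perm_is_matching _ pM).
have p : perm_eq (ends [:: (u, x), (y, v) & M']) [:: u, v & ends M].
  rewrite /= perm_cons perm_sym (permPl (_ : perm_eq _ [:: v, x, y & ends M'])).
    by rewrite (perm_catCA [:: v] [:: x; y]).
  by rewrite perm_cons (perm_ends pM).
rewrite /is_matching (perm_uniq p) /= ux c3_sym vy.
move: allM => /= /andP[_ ->]; rewrite M_uniq !inE negb_or nuv !andbT.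
by move: uU vU; rewrite !inE => -> ->.
Qed.

Let outside_edge p (x : T * T) := outside cl p x.1 x.2.

(* Every edge not counted on the left has exactly one end in class [p]. *)
Lemma count_outside p :
  (count (outside_edge p) M).*2 + #|U :\: free_in cl U p| + t.*2 =
    #|T| + #|free_in cl U p|.
Proof.
have count_ends : (count (outside_edge p) M).*2 + count (fun x => cl x == p) (ends M) =
    count (fun x => cl x != p) (ends M).
  have /andP[_] := M_matching; elim: (M) => //= -[x y] M0 IH /= /andP[xy /IH].
  have := c3_cl xy; rewrite /outside_edge /outside /=.
  case: (eqVneq (cl x) p) => [->|_]; case: (eqVneq (cl y) p) => [E|_] /=;
    rewrite ?E ?eqxx // => _; move: (count _ M0) (count _ (ends M0)) (count _ (ends M0)); lia.
have split_class : t = #|free_in cl U p| + count (fun x => cl x == p) (ends M).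
  rewrite -(card_class p) -(cardsID U) -size_filter; congr (_ + _).
    by apply: eq_card => x; rewrite !inE andbC.
  rewrite -(card_uniqP (filter_uniq _ M_uniq)).
  by apply: eq_card => x; rewrite !inE mem_filter negbK andbC.
have split_U := cardsID (free_in cl U p) U.
have sub : U :&: free_in cl U p = free_in cl U p.
  by apply/setIidPr/subsetP=> x; rewrite inE => /andP[].
rewrite sub in split_U.
have := count_predC (fun x => cl x == p) (ends M); rewrite size_ends.
rewrite -[count (predC _) _]/(count (fun x => cl x != p) (ends M)).
have := card_free; lia.
Qed.

Lemma two_edges a : 1 < count a M -> exists x y x' y',
  [/\ e x y, e x' y', a (x, y), a (x', y') & uniq [:: x; y; x'; y']].
Proof.
move=> aM; have /hasP[[x y] xyM axy] : has a M by rewrite has_count; lia.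
have pM := perm_to_rem xyM; set M' := rem _ _ in pM.
have /hasP[[x' y'] xyM' axy'] : has a M'.
  by move: aM; rewrite has_count ((permP pM) a) /= axy.
exists x, y, x', y'; split=> //.
- by rewrite /e xyM.
- by rewrite /e (perm_mem pM) inE xyM' orbT.
have pM' := perm_to_rem xyM'.
have := M_uniq; rewrite (perm_uniq (perm_ends pM)).
have p : perm_eq ((x, y) :: M') [:: (x, y), (x', y') & rem (x', y') M'].
  by rewrite perm_cons.
rewrite (perm_uniq (perm_ends p)) -[ends _]/([:: x; y; x'; y'] ++ _) cat_uniq.
by case/andP.
Qed.

Let star := star_no_outside H_sym H_irr c1_sym c1_inj no_path e_cl e_blocked.
Let one_class :=
  one_class_no_two_outside H_sym H_irr c1_sym c1_inj no_path e_cl e_blocked.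
Let cherry := cherry_no_two_outside H_sym H_irr c1_sym c1_inj no_path
  H_free e_sym e_cl e_used e_blocked.
Let square := free_square_blocks H_sym H_irr c1_sym c1_inj no_path
  H_free e_sym e_cl e_used e_blocked.
Let triangle := triangle_free H_sym H_irr c1_sym c1_inj no_path H_free.
Let triangle_e := triangle_edge H_sym H_irr c1_sym c1_inj no_path
  H_free e_sym e_cl e_used e_blocked.
Let triangle_2e := triangle_no_two_edges H_sym H_irr c1_sym c1_inj no_path
  H_free e_sym e_cl e_used e_blocked.

Hypothesis I_gt1 : 1 < #|I|.

Lemma two_classes_t : t.*2 <= #|T|.
Proof. by rewrite cardT -mul2n leq_mul2r I_gt1 orbT. Qed.

Lemma free_in_le p : #|free_in cl U p| <= t.
Proof.
by rewrite -(card_class p); apply/subset_leq_card/subsetP => x; rewrite !inE => /andP[].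
Qed.

(** [count_outside] supplies enough matching edges avoiding [p]: one contradicts three free vertices
    in [p], by the star at [c]; two contradict exactly two such vertices, by [cherry]. *)
Lemma free_not_star p c : c \in U -> cl c != p -> #|U :\: free_in cl U p| <= 1 ->
  1 < #|free_in cl U p| -> False.
Proof.
move=> cU cp U1 L2.
have cD : c \in U :\: free_in cl U p by rewrite inE cU andbT inE cU.
have {}U1 : #|U :\: free_in cl U p| = 1.
  by apply/eqP; rewrite eqn_leq U1; apply/card_gt0P; exists c.
have cnt := count_outside p; rewrite U1 in cnt.
have Lt := free_in_le p; have Tt := two_classes_t.
case: (ltnP 2 #|free_in cl U p|) => [L3|L2'].
  have : 0 < count (outside_edge p) M by lia.
  rewrite -has_count => /hasP[[x y] xyM oxy].
  have exy : e x y by rewrite /e xyM.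
  have neq z w : z \in U -> w \notin U -> z != w.
    by move=> zU; apply: contraNneq => <-.
  have ncx : c != x := neq _ _ cU (e_used exy).
  have ncy : c != y by apply: neq cU _; apply: (@e_used y x); rewrite e_sym.
  apply: (star L3 _ ncx ncy exy oxy) => a.
  by case/free_inP=> aU ap; apply: H_free; rewrite // ap eq_sym.
have L2e : #|free_in cl U p| = 2 by lia.
have [x [y [x' [y' [exy exy' oxy oxy' un]]]]] : exists x y x' y',
    [/\ e x y, e x' y', outside_edge p (x, y), outside_edge p (x', y') &
        uniq [:: x; y; x'; y']].
  (* With two classes the equation [cnt] fails by parity; with more, [t >= 2] makes the count at
     least 2. *)
  apply: two_edges; move: cnt; rewrite cardT L2e.
  by case: #|I| I_gt1 => [|[|[|i]]] // _; nia.
have /card_gt1P[a [b [aL bL nab]]] := L2.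
exact: (cherry cU cp aL bL nab exy exy' oxy oxy' un).
Qed.

(** The case split is on how [U] meets the classes. The triangle and square cases leave at most four
    free vertices, so [4 < #|T|] makes [M] non-empty there. *)
Lemma no_augmentation : (size M).*2 + 2 < #|T| -> 4 < #|T| -> False.
Proof.
move=> M_small T_gt4; have U_card := card_free.
have U3 : 2 < #|U| by lia.
have free_notin (s : seq T) : U \subset s -> #|U| <= size s.
  by move/subset_leq_card => h; apply: leq_trans h (card_size s).
have /card_gt0P[u uU] : 0 < #|U| by lia.
case: (boolP [forall v in U, cl v == cl u]) => [/forall_inP allu|].
  have fU : free_in cl U (cl u) = U.
    by apply/setP=> v; rewrite inE andb_idr //; apply: allu.
  have cnt := count_outside (cl u).
  rewrite fU setDv cards0 in cnt; have Tt := two_classes_t.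
  (* Twice the count is [#|T| + #|U| - 2t], which is at least 3. *)
  have /two_edges[x [y [x' [y' [exy exy' oxy oxy' un]]]]] :
    1 < count (outside_edge (cl u)) M by lia.
  by apply: (one_class _ exy exy' oxy oxy' un); rewrite fU.
case/forall_inPn=> v vU nvu; rewrite eq_sym in nvu.
case: (boolP [exists w in U, (cl u != cl w) && (cl v != cl w)]).
  case/exists_inP=> w wU /andP[nuw nvw].
  have /= Uw := free_notin _ (triangle uU vU wU nvu nuw nvw).
  have /hasP[[x y] xyM _] : has predT M by rewrite has_count count_predT; lia.
  have exy : e x y by rewrite /e xyM.
  have /andP[_ xcl] := triangle_e uU vU wU nvu nuw nvw exy.
  (* The class of [x] contains a free vertex besides the covered vertex [x]. *)
  have t2 : 1 < t.
    have [z zU zx] : exists2 z, z \in U & cl z = cl x.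
      by move: xcl; rewrite !inE => /or3P[]/eqP->; [exists u|exists v|exists w].
    rewrite -(card_class (cl x)); apply/card_gt1P; exists z, x.
    rewrite !inE zx eqxx; split=> //.
    by apply: contraNneq (e_used exy) => <-.
  have I3 : 2 < #|I|.
    by apply/card_gt2P; exists (cl u), (cl v), (cl w); rewrite (eq_sym (cl w)).
  (* Of at least six vertices at most three are free, so [M] has a second edge. *)
  have /two_edges[x1 [y1 [x2 [y2 [e1 e2 _ _ un]]]]] : 1 < count predT M.
    have : 6 <= #|T| by rewrite cardT (leq_mul I3 t2).
    by rewrite count_predT; lia.
  exact: (triangle_2e uU vU wU nvu nuw nvw e1 e2 un).
move=> /exists_inPn only_uv.
have other p q : [set p; q] = [set cl u; cl v] -> U :\: free_in cl U p \subset free_in cl U q.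
  move=> pq; apply/subsetP=> w /setDP[wU]; rewrite inE wU /= => nw.
  apply/free_inP; split=> //; apply/eqP; have : cl w \in [set p; q].
    by rewrite pq !inE; have := only_uv w wU; rewrite negb_and !negbK ![_ == cl w]eq_sym.
  by rewrite !inE (negPf nw).
have sub_u := subset_leq_card (other (cl u) (cl v) erefl).
have sub_v := subset_leq_card (other (cl v) (cl u) (setUC _ _)).
have part p : #|free_in cl U p| + #|U :\: free_in cl U p| = #|U|.
  have /setIidPr sub : free_in cl U p \subset U.
    by apply/subsetP=> x; rewrite inE => /andP[].
  by rewrite -(cardsID (free_in cl U p) U) sub.
have [pu pv] := (part (cl u), part (cl v)).
case: (ltnP 1 #|free_in cl U (cl v)|) => [v2|v1].
  case: (ltnP 1 #|free_in cl U (cl u)|) => [u2|u1]; last first.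
    by apply: (free_not_star uU nvu) v2; lia.
  have /card_gt1P[a [a' [aL aL' naa']]] := u2.
  have /card_gt1P[b [b' [bL bL' nbb']]] := v2.
  have [noe U4] := square nvu naa' nbb' aL aL' bL bL'.
  have {U4} /= U4 := free_notin _ U4.
  have /hasP[[x y] xyM _] : has predT M by rewrite has_count count_predT; lia.
  by have := noe x y; rewrite /e xyM.
by apply: (@free_not_star (cl u) v vU); [rewrite eq_sym | lia | lia].
Qed.

End NoAugmentation.

(** Induction on [n]: if no matching has [n + 1] edges, one with [n] edges satisfies the maximality
    hypothesis of [no_augmentation]. *)
Lemma matching_of_size (T I : finType) (cl : T -> I) (t n : nat) (H c1 c3 : rel T) :
  symmetric H -> irreflexive H -> symmetric c1 ->
  (forall a b d, c1 a b -> c1 a d -> b = d) ->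
  (forall a b d e, H a b -> H b d -> H d e ->
    a != d -> b != e -> a != e -> [|| c1 a b, c1 b d | c1 d e]) ->
  symmetric c3 -> (forall x y, c3 x y -> cl x != cl y) ->
  (forall x y, cl x != cl y -> H x y || c3 x y) ->
  (forall p, #|[set x | cl x == p]| = t) -> 1 < #|I| ->
  n.*2 < #|T| -> 4 < #|T| ->
  exists M, is_matching c3 M /\ size M = n.
Proof.
move=> H_sym H_irr c1_sym c1_inj no_path c3_sym c3_cl H_or_c3 card_class I_gt1.
move=> + T_gt4; elim: n => [|n IH] nT; first by exists [::].
have [|M [M_matching sM]] := IH; first by lia.
case: (boolP [exists M' : n.+1.-tuple (T * T), is_matching c3 M']).
  by case/existsP=> M' M'_matching; exists M'; rewrite size_tuple.
move/existsPn=> M_max; exfalso.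
apply: (no_augmentation H_sym H_irr c1_sym c1_inj no_path c3_sym c3_cl H_or_c3
  card_class M_matching _ I_gt1) => // [M' M'_matching|]; last by rewrite sM addn2 -doubleS.
rewrite sM; apply/negP=> sM'; have := M_max (Tuple sM').
by rewrite M'_matching.
Qed.

(** * Monochromatic copies from coloured edges *)

Section Copies.
Variables (G : sgraph) (k : nat) (c : edge_colouring G k) (i : 'I_k).

Definition colour_rel : rel G := fun x y => adj x y && (c [set x; y] == i).

Lemma colour_rel_sym : symmetric colour_rel.
Proof. by move=> x y; rewrite /colour_rel adj_sym setUC. Qed.

Lemma colour_rel_neq x y : colour_rel x y -> x != y.
Proof. by case/andP=> xy _; apply: contraTneq xy => ->; rewrite adj_irr. Qed.

Lemma mono_copy_colour_rel (K : sgraph) (f : K -> G) : injective f ->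
  (forall x y, adj x y -> colour_rel (f x) (f y)) -> mono_copy K c i.
Proof. by move=> f_inj fP; exists f; split=> // x y /fP/andP[-> /eqP]. Qed.

Lemma mono_copy_cherry a b d : colour_rel a b -> colour_rel a d -> b != d ->
  mono_copy (complete_bipartite 1 2) c i.
Proof.
move=> ab ad nbd.
pose f (x : 'I_1 + 'I_2) := match x with inl _ => a | inr j => if val j == 0 then b else d end.
have [nab nad] := (colour_rel_neq ab, colour_rel_neq ad).
apply: (@mono_copy_colour_rel (complete_bipartite 1 2) f).
  case=> [x|x] [y|y] /= => [_|E|E|].
  - by rewrite !ord1.
  - by move: nab nad; rewrite E; case: ifP; rewrite eqxx.
  - by move: nab nad; rewrite -E; case: ifP; rewrite eqxx.
  case: x y => [[|[|x]] ltx] [[|[|y]] lty] //= E; try by rewrite E eqxx in nbd.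
  - by congr inr; apply: val_inj.
  - by congr inr; apply: val_inj.
case=> x [] y //= _; first by case: ifP.
by rewrite colour_rel_sym; case: ifP.
Qed.

Lemma mono_copy_path4 a b d e : colour_rel a b -> colour_rel b d ->
  colour_rel d e -> a != d -> b != e -> a != e -> mono_copy (path_graph 4) c i.
Proof.
move=> ab bd de nad nbe nae.
apply: (@mono_copy_colour_rel (path_graph 4) (fun j => nth a [:: a; b; d; e] (val j))).
  have un : uniq [:: a; b; d; e].
    by rewrite /= !inE !negb_or nad nbe nae (colour_rel_neq ab) (colour_rel_neq bd)
      (colour_rel_neq de).
  by move=> x y /eqP; rewrite nth_uniq ?(ltn_ord x) ?(ltn_ord y) // => /eqP/val_inj.
move=> [[|[|[|[|x]]]] ltx] [[|[|[|[|y]]]] lty] //= _; by rewrite // colour_rel_sym.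
Qed.

Lemma mono_copy_matching M : is_matching colour_rel M ->
  mono_copy (matching_graph (size M)) c i.
Proof.
case/andP=> uniM /allP colM.
pose edge (a : 'I_(size M)) := tnth (in_tuple M) a.
pose f (x : 'I_(size M) * bool) := if x.2 then (edge x.1).2 else (edge x.1).1.
apply: (@mono_copy_colour_rel (matching_graph (size M)) f) => [[a s] [b s']|].
  (* Vertex [(a, s)] goes to position [2a + s] of the list of ends, so [uniq] yields injectivity;
     the default [x0] is arbitrary. *)
  have fE x0 x : f x = nth x0 (ends M) (x.1.*2 + x.2).
    by rewrite nth_ends // /f /edge !(tnth_nth (x0, x0)).
  have lt_ends (x : 'I_(size M)) (r : bool) : x.*2 + r < size (ends M).
    by rewrite size_ends; have := ltn_ord x; case: r; lia.
  rewrite (fE (f (a, s)) (a, s)) (fE (f (a, s)) (b, s')) => /eqP; rewrite nth_uniq ?lt_ends //= => /eqP E.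
  have ab : a = b by apply: val_inj; move: E; case: (s); case: (s') => /=; lia.
  by congr (_, _) => //; move: E; rewrite ab; case: (s); case: (s') => //=; lia.
move=> [a s] [b s'] /andP[/= /eqP<-]; rewrite /f /=.
have ca : colour_rel (edge a).1 (edge a).2 by apply/colM/mem_tnth.
by case: s; case: s' => //= _; rewrite // colour_rel_sym.
Qed.

End Copies.

Theorem theorem1 (j n : nat) (hj : 2 <= j) (hn : 2 <= n) :
  is_multipartite_ramsey j
    (three_graphs (complete_bipartite 1 2) (path_graph 4) (matching_graph n))
    ((2 * n) %/ j + 1).
Proof.
split; first by rewrite addn1.
- move=> c; set t := _ + 1 in c *.
  have jt : 2 * n < j * t.
    by rewrite /t addn1 (mulnC j); apply: ltn_ceil; lia.
  pose i1 := @Ordinal 3 0 isT; pose i2 := @Ordinal 3 1 isT; pose i3 := @Ordinal 3 2 isT.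
  pose T := complete_multipartite j t.
  (* Without a [K_{1,2}] the first colour is a matching; without a [P_4] in the second, every path
     on four vertices in [H] has an edge of the first. *)
  case: (boolP [exists a : T, exists b : T, exists d : T,
    [&& colour_rel c i1 a b, colour_rel c i1 a d & b != d]]).
    case/existsP=> a /existsP[b /existsP[d /and3P[ab ad nbd]]].
    by exists i1; apply: mono_copy_cherry ab ad nbd.
  move=> no_cherry.
  case: (boolP [exists a : T, exists b : T, exists d : T, exists e : T,
    [&& colour_rel c i2 a b, colour_rel c i2 b d, colour_rel c i2 d e,
        a != d, b != e & a != e]]).
    case/existsP=> a /existsP[b /existsP[d /existsP[e]]].
    case/and5P=> ab bd de nad /andP[nbe nae].
    by exists i2; apply: mono_copy_path4 ab bd de nad nbe nae.
  move=> no_path4; exists i3.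
  pose H : rel T := fun x y => colour_rel c i1 x y || colour_rel c i2 x y.
  have card_T : #|T| = j * t by rewrite /= card_prod !card_ord.
  have [M [M_matching <-]] : exists M, is_matching (colour_rel c i3) M /\ size M = n.
    apply: (@matching_of_size T 'I_j fst t n H (colour_rel c i1)).
    + by move=> x y; rewrite /H !(colour_rel_sym _ _ x).
    + by move=> x; rewrite /H /colour_rel adj_irr.
    + exact: colour_rel_sym.
    + move=> a b d ab ad; apply/eqP; apply: contraR no_cherry => nbd.
      by apply/existsP; exists a; apply/existsP; exists b; apply/existsP; exists d; apply/and3P.
    + move=> a b d e hab hbd hde nad nbe nae.
      apply: contraR no_path4; rewrite !negb_or => /and3P[ab bd de].
      apply/existsP; exists a; apply/existsP; exists b; apply/existsP; exists d.
      apply/existsP; exists e; rewrite nad nbe nae !andbT.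
      move: hab hbd hde; rewrite /H (negPf ab) (negPf bd) (negPf de) /=.
      by move=> -> -> ->.
    + exact: colour_rel_sym.
    + by move=> x y /andP[].
    + move=> x y nxy; rewrite /H /colour_rel.
      have -> : adj x y by [].
      by case: (c _) => [[|[|[|m]]] ltm].
    + move=> p; rewrite -[t in RHS]card_ord.
      rewrite -(card_imset predT (can_inj (fun y : 'I_t => erefl y : (p, y).2 = y))).
      apply: eq_card => -[x y]; rewrite !inE /=; apply/eqP/imsetP => [->|[z _ [->]] //].
      by exists y.
    + by rewrite card_ord.
    + by rewrite card_T -mul2n.
    (* Here [n >= 2] enters: [j * t > 2n >= 4]. *)
    + by rewrite card_T; lia.
  exact: mono_copy_matching.
- move=> s s0 arr; rewrite addn1 ltn_divLR; last by lia.
  (* Failure of the lower bound means that there are at most [2n] vertices. *)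
  rewrite ltnNge; apply/negP=> sj.
  have j0 : 0 < j by lia.
  pose T := complete_multipartite j s.
  pose z : T := (Ordinal j0, Ordinal s0).
  (* Indices start at 0: sets containing [z] get the second colour, all others the third. *)
  pose c : edge_colouring T 3 := fun A =>
    if z \in A then @Ordinal 3 1 isT else @Ordinal 3 2 isT.
  have [[[|[|[|m]]] lti] [f [f_inj fP]]] := arr c; last by [].
  + have [_] := fP (inl ord0) (inr ord0) isT.
    by rewrite /c; case: ifP => _ /(congr1 val).
  (* Every edge of the [P_4] would contain [z], but its first and last edges are disjoint. *)
  + have in_edge (x y : 'I_4) : path_adj x y -> z \in [set f x; f y].
      by move=> xy; have [_] := fP x y xy; rewrite /c; case: ifP => // _ /(congr1 val).
    have := in_edge (inord 0) (inord 1); have := in_edge (inord 2) (inord 3).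
    rewrite /path_adj !inordK // => /(_ isT) + /(_ isT); rewrite !inE.
    by case/orP=> /eqP-> /orP[] /eqP/f_inj/(congr1 val); rewrite /= !inordK.
  (* Every vertex of the matching lies on an edge of the third colour, so the copy misses [z] and
     has fewer than [j * s] vertices. *)
  + have avoid x : f x != z.
      case: x => a b.
      have ab : matching_adj (a, b) (a, ~~ b) by rewrite /matching_adj eqxx; case: b.
      have [_] := fP (a, b) (a, ~~ b) ab.
      rewrite /c; case: ifP => [_ /(congr1 val) //|/negbT].
      by rewrite !inE negb_or eq_sym => /andP[].
    have : #|[set: 'I_n * bool]| < #|T|.
      rewrite -(card_imset _ f_inj) -cardsT; apply: proper_card.
      apply/properP; split; first by apply: subsetT.
      exists z; rewrite ?inE //; apply/imsetP=> -[x _ E].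
      by have := avoid x; rewrite E eqxx.
    by rewrite cardsT !card_prod !card_ord card_bool mulnC; lia.
Qed.
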